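(* Let $X$ be a $(0,\pm1)$-valued $n\times n$ matrix. Then $X$ has an alternating sign matrix subordinate if and only if it is not possible to cover the positions of the $+1$ entries of $X$ by a separated family of fewer than $n$ segments in such a way that each position of a $-1$ entry of $X$ is covered by at most one segment of the family.
   Context: An alternating sign matrix (ASM) is a $(0,\pm1)$-valued $n\times n$ matrix in which every row sum and column sum equals $1$ and, in each row and each column, the nonzero entries alternate in sign (equivalently, every row and column sums to $1$ and every initial segment of every row and column has sum $0$ or $1$). A matrix $A$ is a subordinate of $X$ if $A$ can be obtained from $X$ by replacing some nonzero entries of $X$ by $0$. Positions are the elements of $[n]\times[n]$. A horizontal segment is a set $\{(i,j_1),\dots,(i,j_2)\}$ of consecutive positions in a row ($j_1\le j_2$); a vertical segment is a set $\{(i_1,j),\dots,(i_2,j)\}$ of consecutive positions in a column. A system of horizontal segments is separated if its members are pairwise disjoint and no two of them lie in the same row with one ending immediately before the other begins (i.e., each member is a maximal horizontal segment of their union); separated systems of vertical segments are defined analogously. A separated family of segments is $\mathcal I=\mathcal I^1\uplus\mathcal I^2$ where $\mathcal I^1$ is a separated system of horizontal segments and $\mathcal I^2$ is a separated system of vertical segments; the union is taken with multiplicity (a one-element segment occurring in both counts twice), $|\mathcal I|=|\mathcal I^1|+|\mathcal I^2|$, and a position is covered by $\mathcal I$ as many times as the number of members of $\mathcal I$ containing it. *)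

(* Defs.v *)
From HB Require Import structures.
From mathcomp Require Import all_boot all_order all_algebra.

Set Implicit Arguments.
Unset Strict Implicit.
Unset Printing Implicit Defensive.

Import Order.TTheory GRing.Theory Num.Theory.
Local Open Scope ring_scope.

Definition sign_valued (n : nat) (X : 'M[int]_n) : Prop :=
  forall i j, X i j \in [:: 0; 1; -1].

(* Any two consecutive nonzero values of v have opposite signs. *)
Definition alternating (n : nat) (v : 'I_n -> int) : Prop :=
  forall j1 j2 : 'I_n, (j1 < j2)%N -> v j1 != 0 -> v j2 != 0 ->
    (forall j : 'I_n, (j1 < j < j2)%N -> v j = 0) -> v j1 * v j2 < 0.

Definition is_asm (n : nat) (A : 'M[int]_n) : Prop :=
  [/\ sign_valued A,
      forall i, \sum_j A i j = 1,
      forall j, \sum_i A i j = 1,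
      forall i, alternating (fun j => A i j)
    & forall j, alternating (fun i => A i j)].

Definition subordinate (n : nat) (A X : 'M[int]_n) : Prop :=
  forall i j, A i j = X i j \/ A i j = 0.

(* The position (i, j) is in row i and column j. *)
Notation position n := ('I_n * 'I_n)%type.

Definition hseg (n : nat) (i j1 j2 : 'I_n) : {set position n} :=
  [set p : position n | (p.1 == i) && (j1 <= p.2 <= j2)%N].

Definition vseg (n : nat) (j i1 i2 : 'I_n) : {set position n} :=
  [set p : position n | (p.2 == j) && (i1 <= p.1 <= i2)%N].

Definition is_hseg (n : nat) (S : {set position n}) : Prop :=
  exists i j1 j2 : 'I_n, (j1 <= j2)%N /\ S = hseg i j1 j2.

Definition is_vseg (n : nat) (S : {set position n}) : Prop :=
  exists j i1 i2 : 'I_n, (i1 <= i2)%N /\ S = vseg j i1 i2.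

(* Segments are nonempty, so a pairwise disjoint system has no repeated
   member, and a set of segments represents it. *)
Definition separated_hsystem (n : nat) (I : {set {set position n}}) : Prop :=
  [/\ forall S, S \in I -> is_hseg S,
      trivIset I
    & forall i j1 j2 k1 k2 : 'I_n, (j1 <= j2)%N -> (k1 <= k2)%N ->
        hseg i j1 j2 \in I -> hseg i k1 k2 \in I -> k1 <> j2.+1 :> nat].

Definition separated_vsystem (n : nat) (I : {set {set position n}}) : Prop :=
  [/\ forall S, S \in I -> is_vseg S,
      trivIset I
    & forall j i1 i2 k1 k2 : 'I_n, (i1 <= i2)%N -> (k1 <= k2)%N ->
        vseg j i1 i2 \in I -> vseg j k1 k2 \in I -> k1 <> i2.+1 :> nat].

(* A separated family is kept as the pair of its horizontal and vertical
   systems, so a one-element segment lying in both is counted twice. *)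
Definition separated_family (n : nat) (I1 I2 : {set {set position n}}) : Prop :=
  separated_hsystem I1 /\ separated_vsystem I2.

Definition family_card (n : nat) (I1 I2 : {set {set position n}}) : nat :=
  (#|I1| + #|I2|)%N.

Definition cover_mult (n : nat) (I1 I2 : {set {set position n}})
    (p : position n) : nat :=
  (#|[set S in I1 | p \in S]| + #|[set S in I2 | p \in S]|)%N.

(* Main.v *)
(** An alternating sign subordinate of [X] is an integral flow of value [n].
    Each position [p] carries a horizontal node and a vertical node.  Horizontal
    nodes are linked by unit arcs to their right neighbour (the last one to the
    sink), vertical nodes receive a unit arc from the one below (the last one
    from the source), and [p] itself carries an arc of infinite capacity from its
    vertical to its horizontal node if [X p = 1], in the reverse direction if
    [X p = -1].  By conservation the flow on the unit arcs is the row and column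
    prefix sums of the matrix read off the arcs at the positions, so these lie in
    [{0, 1}].  If there is no flow of value [n], a cut [U] of capacity below [n]
    exists; the horizontal runs of nodes in [U] and the vertical runs of nodes
    outside [U] are the segments of the family, one per unit arc cut, and no
    position arc being cut is the covering condition.  Conversely, a segment has
    sum at most 1 in an alternating sign matrix, so weighing the entries by
    their covering multiplicities shows that the family has at least [n]
    members. *)
Require Import Defs.
From HB Require Import structures.
From mathcomp Require Import all_boot all_order all_algebra.
From mathcomp Require Import zify.

Set Implicit Arguments.
Unset Strict Implicit.
Unset Printing Implicit Defensive.

Import Order.TTheory GRing.Theory Num.Theory.

(** * Maximal runs of a set of positions along rows or columns *)

Section Runs.
Variables (n : nat) (P : finType) (line place : P -> 'I_n) (at_ : 'I_n -> 'I_n -> P).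
Hypotheses (lineK : forall i j, line (at_ i j) = i)
  (placeK : forall i j, place (at_ i j) = j)
  (at_K : forall p, at_ (line p) (place p) = p).
Variable B : {set P}.

(** The coordinates are abstract so that rows and columns share one development: [fst] and [snd] as
    [line] and [place] give [hseg], the swapped choice gives [vseg]. *)
Definition segment (i j1 j2 : 'I_n) : {set P} :=
  [set p | (line p == i) && (j1 <= place p <= j2)].

Definition run_end : {set P} :=
  [set p in B | [forall k : 'I_n, (k == (place p).+1 :> nat) ==> (at_ (line p) k \notin B)]].

Definition is_run (t : 'I_n * 'I_n * 'I_n) : bool :=
  let: (i, j1, j2) := t in
  [&& j1 <= j2, [forall k : 'I_n, (j1 <= k <= j2) ==> (at_ i k \in B)],
      [forall k : 'I_n, (k.+1 == j1) ==> (at_ i k \notin B)]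
    & [forall k : 'I_n, (k == j2.+1 :> nat) ==> (at_ i k \notin B)]].

Definition runs : {set {set P}} :=
  [set segment t.1.1 t.1.2 t.2 | t in [set t | is_run t]].

Lemma big_line (R : Type) (idx : R) (op : Monoid.com_law idx) (Q : pred 'I_n)
    (i : 'I_n) (w : P -> R) :
  \big[op/idx]_(p | (line p == i) && Q (place p)) w p =
  \big[op/idx]_(k | Q k) w (at_ i k).
Proof.
rewrite (reindex_onto (at_ i) place) => [|p /andP[/eqP <- _]]; last exact: at_K.
by apply: eq_bigl => k; rewrite lineK placeK !eqxx andbT.
Qed.

Lemma is_runP i j1 j2 : is_run (i, j1, j2) ->
  [/\ j1 <= j2, forall k : 'I_n, j1 <= k <= j2 -> at_ i k \in B,
      forall k : 'I_n, k.+1 = j1 -> at_ i k \notin B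
    & forall k : 'I_n, k = j2.+1 :> nat -> at_ i k \notin B].
Proof.
case/and4P=> le_j /forallP inB /forallP nl /forallP nr; split=> // k.
- by move/implyP: (inB k).
- by move=> kE; move/implyP: (nl k); apply; rewrite kE.
- by move=> kE; move/implyP: (nr k); apply; rewrite kE.
Qed.

(** If the second run stuck out of the first on one side, the place just beyond that end of the
    first would lie in [B], against maximality. *)
Lemma run_le i x j1 j2 k1 k2 : is_run (i, j1, j2) -> is_run (i, k1, k2) ->
  j1 <= x <= j2 -> k1 <= x <= k2 -> (j1 <= k1) && (k2 <= j2).
Proof.
move=> /is_runP[le_j jB jl jr] /is_runP[le_k kB kl kr] xj xk.
apply/andP; split; rewrite leqNgt; apply/negP=> lt.
  have lt' : j1.-1 < n by case: j1 {jB jl le_j xj lt} => /=; lia.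
  have := jl (Ordinal lt'); rewrite kB /=; last by lia.
  by move=> /(_ ltac:(lia)).
have lt' : j2.+1 < n by apply: leq_ltn_trans lt (ltn_ord k2).
have := jr (Ordinal lt'); rewrite kB /=; last by lia.
by move=> /(_ erefl).
Qed.

Lemma run_uniq i x j1 j2 k1 k2 : is_run (i, j1, j2) -> is_run (i, k1, k2) ->
  j1 <= x <= j2 -> k1 <= x <= k2 -> (j1, j2) = (k1, k2).
Proof.
move=> rj rk xj xk; have := run_le rj rk xj xk; have := run_le rk rj xk xj.
by move=> ? ?; congr pair; apply: val_inj => /=; lia.
Qed.

Lemma run_exists p : p \in B ->
  exists j1 j2, is_run (line p, j1, j2) && (j1 <= place p <= j2).
Proof.
move=> pB; set i := line p; set x := place p.
(* The run through [x] is bounded by the least place joined to [x] inside [B] on the left and the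
   greatest one on the right; a neighbour in [B] would contradict extremality. *)
pose Pl (j : 'I_n) := (j <= x) && [forall k : 'I_n, (j <= k <= x) ==> (at_ i k \in B)].
pose Pr (j : 'I_n) := (x <= j) && [forall k : 'I_n, (x <= k <= j) ==> (at_ i k \in B)].
have Plx : Pl x.
  rewrite /Pl leqnn; apply/forallP=> k; apply/implyP=> /andP[le1 le2].
  by have -> : k = x by [apply: val_inj => /=; lia]; rewrite at_K.
have Prx : Pr x.
  rewrite /Pr leqnn; apply/forallP=> k; apply/implyP=> /andP[le1 le2].
  by have -> : k = x by [apply: val_inj => /=; lia]; rewrite at_K.
case: (@arg_minnP _ x Pl (@nat_of_ord n) Plx) => j1 /andP[j1x /forallP j1B] j1m.
case: (@arg_maxnP _ x Pr (@nat_of_ord n) Prx) => j2 /andP[xj2 /forallP j2B] j2m.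
exists j1, j2; rewrite xj2 j1x /= andbT (leq_trans j1x xj2) /=.
apply/and3P; split; apply/forallP=> k; apply/implyP.
- move=> /andP[le1 le2]; have [le|/ltnW le] := leqP k x.
    by move/implyP: (j1B k); apply; rewrite le1.
  by move/implyP: (j2B k); apply; rewrite le.
- move=> /eqP kE; apply/negP=> kB; suff /j1m : Pl k by lia.
  apply/andP; split; first by lia.
  apply/forallP=> l; apply/implyP=> /andP[le1 le2].
  have [->//|lk] := eqVneq l k; move/implyP: (j1B l); apply; rewrite le2 andbT.
  by move: lk; rewrite -val_eqE /=; lia.
- move=> /eqP kE; apply/negP=> kB; suff /j2m : Pr k by lia.
  apply/andP; split; first by lia.
  apply/forallP=> l; apply/implyP=> /andP[le1 le2].
  have [->//|lk] := eqVneq l k; move/implyP: (j2B l); apply; rewrite le1 /=.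
  by move: lk; rewrite -val_eqE /=; lia.
Qed.

Lemma segment_inj (i j1 j2 i' k1 k2 : 'I_n) : j1 <= j2 -> k1 <= k2 ->
  segment i j1 j2 = segment i' k1 k2 -> (i, j1, j2) = (i', k1, k2).
Proof.
move=> le_j le_k /setP eqS.
have := eqS (at_ i j1); have := eqS (at_ i j2).
have := eqS (at_ i' k1); have := eqS (at_ i' k2).
rewrite !inE !lineK !placeK !eqxx !leqnn le_j le_k /= => e1 e2.
have -> : i' = i by move: e1 => /andP[/eqP].
rewrite eqxx /= => e3 e4; move: e1 e2 => /andP[_ e1] /andP[_ e2].
by congr (_, _, _); apply: val_inj => /=; lia.
Qed.

Lemma mem_runs (i j1 j2 : 'I_n) : j1 <= j2 ->
  (segment i j1 j2 \in runs) = is_run (i, j1, j2).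
Proof.
move=> le_j; apply/imsetP/idP=> [[[[i' k1] k2] /=]|rj]; last first.
  by exists (i, j1, j2); rewrite ?inE.
rewrite inE => rk eqS; have [le_k _ _ _] := is_runP rk.
by case: (segment_inj le_j le_k eqS) => -> -> ->.
Qed.

Lemma runsP S : S \in runs ->
  exists i j1 j2, is_run (i, j1, j2) /\ S = segment i j1 j2.
Proof.
by case/imsetP=> -[[i j1] j2]; rewrite inE => rt ->; exists i, j1, j2.
Qed.

Lemma runs_segment S : S \in runs ->
  exists i j1 j2 : 'I_n, j1 <= j2 /\ S = segment i j1 j2.
Proof.
by move/runsP=> [i [j1 [j2 [/is_runP[le_j _ _ _] ->]]]]; exists i, j1, j2.
Qed.

Lemma runs_meet S S' p :
  S \in runs -> S' \in runs -> p \in S -> p \in S' -> S = S'.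
Proof.
move=> /runsP[i [j1 [j2 [rj ->]]]] /runsP[i' [k1 [k2 [rk ->]]]].
rewrite !inE => /andP[/eqP iE xj] /andP[/eqP iE' xk].
by move: rk; rewrite -iE' iE => rk; case: (run_uniq rj rk xj xk) => -> ->.
Qed.

Lemma trivIset_runs : trivIset runs.
Proof.
apply/trivIsetP=> S S' SR SR'; apply: contraR => /pred0Pn[p /= /andP[pS pS']].
by apply/eqP; apply: runs_meet pS pS'.
Qed.

Lemma runs_separated (i j1 j2 k1 k2 : 'I_n) : j1 <= j2 -> k1 <= k2 ->
  segment i j1 j2 \in runs -> segment i k1 k2 \in runs -> k1 <> j2.+1 :> nat.
Proof.
move=> le_j le_k; rewrite !mem_runs // => /is_runP[_ _ _ jr] /is_runP[_ kB _ _] kE.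
by have := jr _ kE; rewrite kB // leqnn.
Qed.

(** A run is determined by its line and its last place, and the position there belongs to
    [run_end]. *)
Lemma card_runs : #|runs| <= #|run_end|.
Proof.
apply: leq_trans (leq_imset_card _ _) _.
set R := [set t | is_run t]; pose e (t : 'I_n * 'I_n * 'I_n) := at_ t.1.1 t.2.
have e_inj : {in R &, injective e}.
  move=> [[i j1] j2] [[i' k1] k2]; rewrite !inE /e /= => rj rk eq_e.
  have iE : i = i' by rewrite -[i](lineK _ j2) eq_e lineK.
  have jE : j2 = k2 by rewrite -[j2](placeK i) eq_e placeK.
  move: rk; rewrite -iE -jE => rk.
  have [le_j _ _ _] := is_runP rj; have [le_k _ _ _] := is_runP rk.
  have xj : j1 <= j2 <= j2 by rewrite le_j leqnn.
  have xk : k1 <= j2 <= j2 by rewrite le_k leqnn.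
  by case: (run_uniq rj rk xj xk) => ->.
rewrite -(card_in_imset e_inj) subset_leq_card //; apply/subsetP=> p /imsetP[].
move=> [[i j1] j2]; rewrite inE => /is_runP[le_j jB _ jr] ->.
rewrite inE /e /= jB ?leqnn ?andbT //; apply/forallP=> k.
by rewrite lineK placeK; apply/implyP=> /eqP kE; apply: jr.
Qed.

(** Runs stay inside [B], pass through each of its positions, and coincide when they meet. Covering
    multiplicities thus become membership tests. *)
Lemma runs_cover p : #|[set S in runs | p \in S]| = (p \in B).
Proof.
have [pB|pNB] := boolP (p \in B).
  have [j1 [j2 /andP[rj xj]]] := run_exists pB.
  have SR : segment (line p) j1 j2 \in runs.
    by rewrite mem_runs //; have [] := is_runP rj.
  have pS : p \in segment (line p) j1 j2 by rewrite inE eqxx.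
  apply/eqP/cards1P; exists (segment (line p) j1 j2).
  apply/setP=> S; rewrite !inE; apply/andP/eqP=> [[SR' pS']|->//].
  exact: runs_meet pS' pS.
apply: eq_card0 => S; rewrite !inE; apply: contraNF pNB => /andP[].
move=> /runsP[i [j1 [j2 [/is_runP[_ jB _ _] ->]]]]; rewrite inE => /andP[/eqP iE xj].
by rewrite -[p]at_K iE jB.
Qed.

End Runs.

Local Open Scope ring_scope.

(** * Integral flows and the max-flow min-cut alternative *)

Section Flow.
Variables (V E : finType) (src dst : E -> V) (c : E -> int).
Implicit Types (f g : E -> int) (u v x : V) (e : E).

Definition net_outflow f u : int :=
  \sum_e f e * ((src e == u)%:R - (dst e == u)%:R).

Definition residual f : rel V := fun u v =>
  [exists e, [&& src e == u, dst e == v & f e < c e]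
          || [&& src e == v, dst e == u & 0 < f e]].

Definition is_flow (s t : V) f (k : nat) : Prop :=
  [/\ forall e, 0 <= f e <= c e,
      forall u, u != s -> u != t -> net_outflow f u = 0
    & net_outflow f s = k%:Z].

Lemma net_outflowD f g u :
  net_outflow (fun e => f e + g e) u = net_outflow f u + net_outflow g u.
Proof. by rewrite -big_split; apply: eq_bigr => e _; rewrite mulrDl. Qed.

Lemma net_outflow_single e0 (z : int) u :
  net_outflow (fun e => if e == e0 then z else 0) u =
  z * ((src e0 == u)%:R - (dst e0 == u)%:R).
Proof.
rewrite /net_outflow (bigD1 e0) //= eqxx big1 ?addr0 // => e /negPf ->.
by rewrite mul0r.
Qed.

(** Summation by parts. When [phi] is the indicator of a vertex set, this computes the net flow
    leaving that set. *)
Lemma sum_net_outflow (phi : V -> int) f :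
  \sum_u phi u * net_outflow f u = \sum_e f e * (phi (src e) - phi (dst e)).
Proof.
under eq_bigr => u _ do rewrite mulr_sumr.
rewrite exchange_big /=; apply: eq_bigr => e _.
have sum_delta w : \sum_u phi u * (w == u)%:R = phi w.
  rewrite (bigD1 w) //= eqxx mulr1 big1 ?addr0 // => u.
  by rewrite eq_sym => /negPf ->; rewrite mulr0.
under eq_bigr => u _ do rewrite mulrCA mulrBr.
by rewrite -mulr_sumr sumrB !sum_delta.
Qed.

(** Augmentation along a residual path, built from its end backwards. The two support clauses keep
    the arc of a new first step disjoint from the later ones, so that each arc changes by at most
    one unit. *)
Lemma residual_path_flow f x p :
    (forall e, 0 <= f e <= c e) -> path (residual f) x p -> uniq (x :: p) ->
  exists g, [/\ forall e, src e \notin x :: p -> g e = 0,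
      forall e, dst e \notin x :: p -> g e = 0,
      forall e, 0 <= f e + g e <= c e
    & forall u, net_outflow g u = (x == u)%:R - (last x p == u)%:R].
Proof.
move=> fP; elim: p x => [|y p IHp] x.
  exists (fun=> 0); split=> // [e|u]; first by rewrite addr0.
  by rewrite /net_outflow big1 ?subrr // => e _; rewrite mul0r.
move=> /= /andP[/existsP[e0 e0P] yp] /andP[xNyp Uyp].
have [g [gs gd gP gO]] := IHp y yp Uyp.
(* One end of [e0] is [x], which the rest of the path avoids. *)
have ge0 : g e0 = 0.
  by case/orP: e0P => /and3P[/eqP sE /eqP dE _];
    [apply: gs; rewrite sE | apply: gd; rewrite dE].
pose z : int := if (src e0 == x) && (f e0 < c e0) && (dst e0 == y) then 1 else -1.
exists (fun e => (if e == e0 then z else 0) + g e).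
have [s_in d_in] : src e0 \in x :: y :: p /\ dst e0 \in x :: y :: p.
  by case/orP: e0P => /and3P[/eqP-> /eqP-> _]; rewrite !inE !eqxx ?orbT.
split=> [e eN|e eN|e|u].
- case: eqP eN => [->|_ eN]; first by rewrite s_in.
  by rewrite add0r gs //; apply: contra eN; rewrite [in X in _ -> X]inE orbC => ->.
- case: eqP eN => [->|_ eN]; first by rewrite d_in.
  by rewrite add0r gd //; apply: contra eN; rewrite [in X in _ -> X]inE orbC => ->.
- case: eqP => [->|_]; last by rewrite add0r; apply: gP.
  rewrite ge0 addr0 /z; have := fP e0; case: ifP => [/andP[/andP[_]]|zN]; first by lia.
  case/orP: e0P zN => /and3P[sE dE]; last by lia.
  by rewrite sE dE /= => ->.
- rewrite net_outflowD net_outflow_single gO /z.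
  case: ifP => [/andP[/andP[/eqP-> _] /eqP->]|zN]; first by rewrite mul1r addrA subrK.
  case/orP: e0P zN => /and3P[sE dE fE]; first by rewrite sE dE fE.
  by rewrite (eqP sE) (eqP dE) mulN1r opprB addrA subrK.
Qed.

(** Induction on [k]: a flow of value [k] is augmented by one unit if the residual graph joins [s]
    to [t]. Otherwise the vertices reachable from [s] form a cut of capacity exactly [k]. *)
Lemma max_flow_min_cut (s t : V) (k : nat) : s != t -> (forall e, 0 <= c e) ->
  (exists f, is_flow s t f k) \/
  (exists U : {set V}, [/\ s \in U, t \notin U
     & \sum_(e | (src e \in U) && (dst e \notin U)) c e < k%:Z]).
Proof.
move=> sNt c_ge0; elim: k => [|k [[f [fP fC fS]]|[U [sU tU lt_c]]]]; last 2 first.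
- have [/connectP[p0 ep0 tE]|tN] := boolP (connect (residual f) s t).
    left; case/shortenP: ep0 tE => p ep Up _ tE.
    have [g [_ _ gP gO]] := residual_path_flow fP ep Up.
    exists (fun e => f e + g e); split=> // [u us ut|].
      by rewrite net_outflowD fC // gO -tE ![_ == u]eq_sym (negPf us) (negPf ut).
    by rewrite net_outflowD fS gO -tE eqxx eq_sym (negPf sNt); lia.
  right; pose U := [set u | connect (residual f) s u].
  exists U; split; rewrite ?inE ?connect0 //.
  have : \sum_u (u \in U)%:R * net_outflow f u = k%:Z.
    rewrite (bigD1 s) //= inE connect0 mul1r fS big1 ?addr0 // => u us.
    have [->|ut] := eqVneq u t; first by rewrite inE (negPf tN) mul0r.
    by rewrite fC // mulr0.
  rewrite sum_net_outflow => cutE.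
  suff -> : \sum_(e | (src e \in U) && (dst e \notin U)) c e = k%:Z by lia.
  (* Since [U] is closed under residual arcs, arcs leaving it are saturated and arcs entering it
     carry no flow. *)
  rewrite -cutE big_mkcond; apply: eq_bigr => e _.
  have /andP[f_ge0 f_le] := fP e.
  have closed_U u v : u \in U -> residual f u v -> v \in U.
    by rewrite !inE => su uv; apply: connect_trans su (connect1 uv).
  case: (boolP (src e \in U)) => sU; case: (boolP (dst e \in U)) => dU /=;
    rewrite ?subrr ?mulr0 //.
    rewrite subr0 mulr1; apply/eqP; rewrite eq_le f_le andbT leNgt.
    apply: contra dU => fe; apply: closed_U sU _.
    by apply/existsP; exists e; rewrite !eqxx fe.
  have [fe|] := ltP 0 (f e); last by move=> f0; have -> : f e = 0 by lia.
  case/negP: sU; apply: closed_U dU _.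
  by apply/existsP; exists e; rewrite !eqxx fe orbT.
- by right; exists U; split=> //; lia.
- left; exists (fun=> 0); split=> [e|u _ _|]; rewrite ?lexx ?c_ge0 //.
    by rewrite /net_outflow big1 // => e _; rewrite mul0r.
  by rewrite /net_outflow big1 // => e _; rewrite mul0r.
Qed.

End Flow.

(** * Segment and prefix sums of alternating vectors *)

Lemma sum_ord_recr (n : nat) (v : 'I_n -> int) (P : pred nat) (b : 'I_n) :
  (forall j, P j -> j < b)%N ->
  \sum_(j < n | P j || (j == b :> nat)) v j = \sum_(j < n | P j) v j + v b.
Proof.
move=> Pb; rewrite (bigD1 b) ?eqxx ?orbT //= addrC; congr (_ + _).
apply: eq_bigl => j; rewrite -val_eqE /=.
case: (boolP (P j)) => [/Pb lt|_] /=; first by apply/eqP; lia.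
by rewrite andbN.
Qed.

Lemma alternating_segment_sum (n : nat) (v : 'I_n -> int) (a b : nat) :
  (forall j, v j \in [:: 0; 1; -1]) -> alternating v ->
  \sum_(j < n | (a <= j < b)%N) v j <= 1.
Proof.
move=> vS vA.
pose sum b := \sum_(j < n | (a <= j < b)%N) v j.
(* Invariant as the right end grows: with [l] the last nonzero place met, the sum is [0] or [v l].
   The next nonzero value is opposite to [v l], so it either cancels the sum or becomes the sum. *)
have [|] : ((forall j : 'I_n, a <= j < b -> v j = 0)%N /\ sum b = 0)
    \/ (exists2 l : 'I_n, (a <= l < b)%N /\ v l != 0 &
        (forall j : 'I_n, l < j < b -> v j = 0)%N /\ (sum b = 0 \/ sum b = v l)).
- elim: b => [|b IHb].
    left; split=> [j|]; first by lia.
    by rewrite /sum big_pred0 // => j; rewrite ltn0 andbF.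
  have [bn|nb] := ltnP b n; last first.
    have -> : sum b.+1 = sum b.
      by apply: eq_bigl => j; have := ltn_ord j; lia.
    case: IHb => [[v0 s0]|[l [lab l0] [v0 sl]]]; [left|right].
      by split=> // j jP; apply: v0; have := ltn_ord j; lia.
    exists l; first by split=> //; lia.
    by split=> // j jP; apply: v0; have := ltn_ord j; lia.
  have [ba|ab] := ltnP b a.
    left; split=> [j|]; first by lia.
    by rewrite /sum big_pred0 // => j; lia.
  pose o := Ordinal bn.
  have sE : sum b.+1 = sum b + v o.
    rewrite -[RHS](@sum_ord_recr _ _ (fun j => a <= j < b)%N) => [|j /=]; last by lia.
    by apply: eq_bigl => j /=; lia.
  have eq_o (j : 'I_n) : ~ (j < b)%N -> (j < b.+1)%N -> j = o.
    by move=> ? ?; apply: val_inj => /=; lia.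
  have [o0|oN0] := eqVneq (v o) 0.
    rewrite sE o0 addr0; case: IHb => [[v0 s0]|[l [lab l0] [v0 sl]]]; [left|right].
      split=> // j jP; have [jb|jb] := boolP (j < b)%N; first by apply: v0; lia.
      by rewrite (eq_o j) //; [apply/negP|lia].
    exists l; first by split=> //; lia.
    split=> // j jP; have [jb|jb] := boolP (j < b)%N; first by apply: v0; lia.
    by rewrite (eq_o j) //; [apply/negP|lia].
  right; exists o; first by split=> //=; lia.
  split=> [j /=|]; first by lia.
  rewrite sE; case: IHb => [[_ ->]|[l [lab l0] [v0 sl]]]; first by right; rewrite add0r.
  have := vA l o (ltac:(by case/andP: lab)) l0 oN0 v0.
  move: sl (vS l) (vS o); rewrite !inE.
  by move=> [->|->] /or3P[] /eqP-> /or3P[] /eqP->; lia.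
- by rewrite -/(sum b) => -[_ ->].
- rewrite -/(sum b) => -[l _ [_ [->//|->]]].
  by move: (vS l); rewrite !inE => /or3P[] /eqP->.
Qed.

Section PrefixSums.
Variables (n : nat) (v : 'I_n -> int).
Hypothesis prefix01 : forall j : 'I_n, 0 <= \sum_(k < n | (k <= j)%N) v k <= 1.

Lemma prefix01_lt (j : 'I_n) : 0 <= \sum_(k < n | (k < j)%N) v k <= 1.
Proof.
case: j => [[|j] lt_j] /=; first by rewrite big_pred0.
exact: (prefix01 (Ordinal (ltnW lt_j))).
Qed.

Lemma prefix01_recr (j : 'I_n) :
  \sum_(k < n | (k <= j)%N) v k = \sum_(k < n | (k < j)%N) v k + v j.
Proof.
rewrite -(@sum_ord_recr _ _ (fun k => k < j)%N) //.
by apply: eq_bigl => k; rewrite leq_eqVlt orbC.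
Qed.

Lemma prefix01_bound j : -1 <= v j <= 1.
Proof. by have := prefix01 j; have := prefix01_lt j; rewrite prefix01_recr; lia. Qed.

(** The prefix sum does not change between [j1] and [j2]. It is 1 after an entry [1] and 0 after an
    entry [-1], which forces the sign of the next nonzero entry. *)
Lemma prefix01_alternating : alternating v.
Proof.
move=> j1 j2 lt12 v1 v2 v0.
have : \sum_(k < n | (k < j2)%N) v k = \sum_(k < n | (k <= j1)%N) v k.
  rewrite (bigID (fun k : 'I_n => k <= j1)%N) /= [X in _ + X]big1 ?addr0 => [|k kP].
    by apply: eq_bigl => k; lia.
  by apply: v0; lia.
have := prefix01 j1; have := prefix01_lt j1; rewrite prefix01_recr.
have := prefix01 j2; have := prefix01_lt j2; rewrite prefix01_recr.
have := prefix01_bound j1; have := prefix01_bound j2.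
have [->|->] : v j1 = 1 \/ v j1 = -1 by have := prefix01_bound j1; lia.
  by lia.
by lia.
Qed.

End PrefixSums.

Lemma prefix01_total (n : nat) (v : 'I_n -> int) :
  (forall j : 'I_n, 0 <= \sum_(k < n | (k <= j)%N) v k <= 1) -> \sum_j v j <= 1.
Proof.
case: n v => [|n] v pre; first by rewrite big_ord0.
have /andP[_] := pre ord_max; congr (_ <= _).
by apply: eq_bigl => k /=; rewrite -ltnS ltn_ord.
Qed.

(** * Double counting: a covering family has at least [n] members *)

Lemma sum_over_members (P : finType) (I : {set {set P}}) (w : P -> int) :
  \sum_(S in I) \sum_(p in S) w p = \sum_p w p * #|[set S in I | p \in S]|%:R.
Proof.
rewrite (exchange_big_dep predT) //=; apply: eq_bigr => p _.
by rewrite sumr_const mulr_natr; congr (_ *+ _); apply: eq_card => S; rewrite !inE.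
Qed.

(** The differences [1 - w j] are nonnegative and add up to zero. *)
Lemma eq1_of_sum_eq_card (n : nat) (w : 'I_n -> int) :
  (forall j, w j <= 1) -> \sum_j w j = n%:Z -> forall j, w j = 1.
Proof.
move=> w_le1 sum_w j.
have : \sum_j (1 - w j) = 0.
  by rewrite sumrB sum_w sumr_const card_ord natz subrr.
move/psumr_eq0P => /(_ _ j isT) w0; apply/esym/eqP; rewrite -subr_eq0 w0 //.
by move=> k _; rewrite subr_ge0.
Qed.

Lemma sum_last_row (n : nat) (w : 'I_n -> int) :
  \sum_(p : position n | p.1.+1 == n) w p.2 = \sum_j w j.
Proof.
case: n w => [|n] w; first by rewrite big_ord0 big1 // => -[[]].
rewrite -(@big_line _ _ fst snd pair _ _ _ _ _ _ predT ord_max (fun p => w p.2)) //.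
  by apply: eq_bigl => p; rewrite andbT -val_eqE /= eqSS.
by case.
Qed.

Lemma asm_separated_family_card (n : nat) (A : 'M[int]_n)
    (I1 I2 : {set {set position n}}) :
    is_asm A -> separated_family I1 I2 ->
    (forall i j, A i j = 1 -> (1 <= cover_mult I1 I2 (i, j))%N) ->
    (forall i j, A i j = -1 -> (cover_mult I1 I2 (i, j) <= 1)%N) ->
  (n <= family_card I1 I2)%N.
Proof.
move=> [As Ar _ Ah Av] [[I1s _ _] [I2s _ _]] Apos Aneg.
pose w (p : position n) := A p.1 p.2.
have segments_le (I : {set {set position n}}) :
    (forall S, S \in I -> \sum_(p in S) w p <= 1) ->
    \sum_p w p * #|[set S in I | p \in S]|%:R <= #|I|%:Z.
  move=> SI; rewrite -sum_over_members -natz -sumr_const.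
  by apply: ler_sum => S /SI.
have le1 : \sum_p w p * #|[set S in I1 | p \in S]|%:R <= #|I1|%:Z.
  apply: segments_le => S /I1s[i [j1 [j2 [_ ->]]]].
  under eq_bigl => p do rewrite inE.
  rewrite (@big_line _ _ fst snd pair _ _ _ _ _ _
    (fun k : 'I_n => j1 <= k <= j2)%N i w) //; last by case.
  exact: (alternating_segment_sum j1 j2.+1 (As i) (Ah i)).
have le2 : \sum_p w p * #|[set S in I2 | p \in S]|%:R <= #|I2|%:Z.
  apply: segments_le => S /I2s[j [i1 [i2 [_ ->]]]].
  under eq_bigl => p do rewrite inE.
  rewrite (@big_line _ _ snd fst (fun j i => (i, j)) _ _ _ _ _ _
    (fun k : 'I_n => i1 <= k <= i2)%N j w) //; last by case.
  exact: (alternating_segment_sum i1 i2.+1 (fun i => As i j) (Av j)).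
(* The entries of [A] add up to [n]. Weighting by multiplicity lowers no term: a [1] has weight at
   least 1, a [-1] has weight at most 1. *)
have : n%:Z <= \sum_p w p * (cover_mult I1 I2 p)%:R.
  have -> : n%:Z = \sum_p w p.
    rewrite -(pair_bigA _ (fun i j => A i j)) /=.
    by under eq_bigr => i _ do rewrite Ar; rewrite sumr_const card_ord natz.
  apply: ler_sum => -[i j] _; rewrite /w /=; have := As i j.
  have := Apos i j; have := Aneg i j; rewrite !inE.
  by move=> An Ap /or3P[] /eqP Aij; rewrite Aij in An Ap *;
    [rewrite !mul0r | have := Ap erefl | have := An erefl]; lia.
rewrite /cover_mult; under eq_bigr => p _ do rewrite natrD mulrDr.
rewrite big_split -lez_nat PoszD => /le_trans; apply; exact: lerD le1 le2.
Qed.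

(** * The network of a sign matrix *)

Section AsmNetwork.
Variables (n : nat) (X : 'M[int]_n).
Hypothesis X_sign : sign_valued X.

Let node := (bool + bool * position n)%type.
(* In order: the arcs leaving the horizontal nodes, those entering the vertical
   nodes, and those joining the two nodes of a position. *)
Let arc := (position n + position n + position n)%type.

Let source : node := inl true.
Let sink : node := inl false.
Let hnode (p : position n) : node := inr (true, p).
Let vnode (p : position n) : node := inr (false, p).

Let right_of (p : position n) : node :=
  if insub p.2.+1 is Some k then hnode (p.1, k) else sink.
Let below (p : position n) : node :=
  if insub p.1.+1 is Some k then vnode (k, p.2) else source.

(** Zero entries also get an arc, oriented as for [-1]; its capacity 0 makes it harmless. *)
Let src (a : arc) : node :=
  match a with
  | inl (inl p) => hnode p
  | inl (inr p) => below p
  | inr p => if X p.1 p.2 == 1 then vnode p else hnode p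
  end.
Let dst (a : arc) : node :=
  match a with
  | inl (inl p) => right_of p
  | inl (inr p) => vnode p
  | inr p => if X p.1 p.2 == 1 then hnode p else vnode p
  end.
(* [n] acts as an infinite capacity, as only cuts below [n] matter. *)
Let cap (a : arc) : int :=
  match a with
  | inl _ => 1
  | inr p => if X p.1 p.2 == 0 then 0 else n%:Z
  end.

Lemma cap_ge0 a : 0 <= cap a.
Proof. by case: a => [//|p] /=; case: ifP. Qed.

(** * From a flow of value [n] to an alternating sign matrix *)

Section FlowToAsm.
Variable f : arc -> int.
Hypothesis f_flow : is_flow src dst cap source sink f n.

(** The capacities of the position arcs do not bound the entries by 1; that bound will come from the
    prefix sums. *)
Let A : 'M[int]_n := \matrix_(i, j) (X i j * f (inr (i, j))).

Lemma conservation (phi : node -> int) : phi source = 0 -> phi sink = 0 ->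
  \sum_a f a * (phi (src a) - phi (dst a)) = 0.
Proof.
case: f_flow => _ fC _ phis phit; rewrite -sum_net_outflow big1 // => u _.
have [->|us] := eqVneq u source; first by rewrite phis mul0r.
have [->|ut] := eqVneq u sink; first by rewrite phit mul0r.
by rewrite fC // mulr0.
Qed.

(** Reversing the arc for [-1] matches the sign of the entry: in every case the position sends a net
    [A p.1 p.2] from its vertical to its horizontal node. *)
Lemma xarc_flow (phi psi : position n -> int) p :
  f (inr p) * ((if X p.1 p.2 == 1 then phi p else psi p)
             - (if X p.1 p.2 == 1 then psi p else phi p)) =
  A p.1 p.2 * (phi p - psi p).
Proof.
rewrite mxE -surjective_pairing; case: f_flow => fb _ _; have := fb (inr p) => /=.
have := X_sign p.1 p.2; rewrite !inE => /or3P[] /eqP-> /=.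
- by rewrite -eq_le => /eqP <-; rewrite !mul0r.
- by rewrite mul1r.
- by rewrite mulN1r mulNr -mulrN opprB.
Qed.

(** Flow balance of the horizontal nodes of row [i] up to column [j]: the position arcs bring in the
    prefix sum, and it leaves by the unit arc from [(i, j)]. *)
Lemma row_prefix (i j : 'I_n) : \sum_(k < n | (k <= j)%N) A i k = f (inl (inl (i, j))).
Proof.
pose phi (u : node) : int :=
  if u is inr (true, p) then ((p.1 == i) && (p.2 <= j)%N)%:R else 0.
have := @conservation phi erefl erefl.
rewrite !big_sumType /= [X in _ + X + _]big1 ?addr0 => [|p _]; last first.
  by rewrite /below; case: insub => [k|]; rewrite subrr mulr0.
(* Every horizontal unit arc other than the one from [(i, j)] has both ends in the set or
   neither. *)
rewrite (bigD1 (i, j)) //= eqxx leqnn [X in _ + X + _]big1 ?addr0 => [|p pN]; last first.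
  have -> : phi (right_of p) = ((p.1 == i) && (p.2 < j)%N)%:R.
    rewrite /right_of; case: insubP => [k _ kE|]; first by rewrite /= kE.
    rewrite -leqNgt => le_n; have -> : (p.2 < j)%N = false by have := ltn_ord j; lia.
    by rewrite andbF.
  suff -> : (p.1 == i) && (p.2 <= j)%N = (p.1 == i) && (p.2 < j)%N by rewrite subrr mulr0.
  case: (p.1 =P i) pN => //= pi; case: p pi => i' j' /= ->; rewrite xpair_eqE eqxx /=.
  by rewrite -val_eqE /= leq_eqVlt => /negPf ->.
have -> : phi (right_of (i, j)) = 0.
  by rewrite /right_of; case: insubP => [k _ kE|//] /=; rewrite kE ltnn andbF.
rewrite subr0 mulr1.
under eq_bigr => p _ do
  rewrite 2!(fun_if phi) (@xarc_flow (phi \o vnode) (phi \o hnode)) /= sub0r mulrN.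
rewrite sumrN => /eqP; rewrite subr_eq0 => /eqP->.
rewrite -(@big_line _ _ fst snd pair _ _ _ _ _ _
  (fun k : 'I_n => k <= j)%N i (fun p => A p.1 p.2)) //; last by case.
by rewrite big_mkcond; apply: eq_bigr => p _; case: ifP; rewrite ?mulr1 ?mulr0.
Qed.

(** Balance of the vertical nodes of column [j] down to row [i]: flow enters by the unit arc into
    [(i, j)] and leaves through the position arcs. *)
Lemma col_prefix (i j : 'I_n) : \sum_(k < n | (k <= i)%N) A k j = f (inl (inr (i, j))).
Proof.
pose phi (u : node) : int :=
  if u is inr (false, p) then ((p.2 == j) && (p.1 <= i)%N)%:R else 0.
have := @conservation phi erefl erefl.
rewrite !big_sumType /= [X in X + _ + _]big1 ?add0r => [|p _]; last first.
  by rewrite /right_of; case: insub => [k|]; rewrite subrr mulr0.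
rewrite (bigD1 (i, j)) //= eqxx leqnn [X in _ + X + _]big1 ?addr0 => [|p pN]; last first.
  have -> : phi (below p) = ((p.2 == j) && (p.1 < i)%N)%:R.
    rewrite /below; case: insubP => [k _ kE|]; first by rewrite /= kE.
    rewrite -leqNgt => le_n; have -> : (p.1 < i)%N = false by have := ltn_ord i; lia.
    by rewrite andbF.
  suff -> : (p.2 == j) && (p.1 <= i)%N = (p.2 == j) && (p.1 < i)%N by rewrite subrr mulr0.
  case: (p.2 =P j) pN => //= pj; case: p pj => i' j' /= ->; rewrite xpair_eqE eqxx andbT /=.
  by rewrite -val_eqE /= leq_eqVlt => /negPf ->.
have -> : phi (below (i, j)) = 0.
  by rewrite /below; case: insubP => [k _ kE|//] /=; rewrite kE ltnn andbF.
rewrite sub0r mulrN1.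
under eq_bigr => p _ do
  rewrite 2!(fun_if phi) (@xarc_flow (phi \o vnode) (phi \o hnode)) /= subr0.
rewrite addrC => /eqP; rewrite subr_eq0 => /eqP<-.
rewrite -(@big_line _ _ snd fst (fun j i => (i, j)) _ _ _ _ _ _
  (fun k : 'I_n => k <= i)%N j (fun p => A p.1 p.2)) //; last by case.
by rewrite big_mkcond; apply: eq_bigr => p _; case: ifP; rewrite ?mulr1 ?mulr0.
Qed.

(** The source emits flow only on the unit arcs into the last row, and each of these carries a full
    column sum by [col_prefix]. *)
Lemma flow_sum : \sum_j \sum_i A i j = n%:Z.
Proof.
case: f_flow => _ _ <-; rewrite /net_outflow !big_sumType /=.
rewrite [X in X + _ + _]big1 ?add0r => [|p _]; last first.
  by rewrite /right_of; case: insub => [k|]; rewrite subrr mulr0.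
rewrite [X in _ + X]big1 ?addr0 => [|p _]; last first.
  by case: (X _ _ == 1); rewrite subrr mulr0.
rewrite -sum_last_row big_mkcond; apply: eq_bigr => p _; rewrite /below.
case: insubP => [k lt_k _|] /=; first by rewrite subrr mulr0; case: eqP => //; lia.
rewrite -leqNgt => le_n; rewrite eqn_leq le_n ltn_ord subr0 mulr1.
rewrite [p in RHS]surjective_pairing -col_prefix; apply: eq_bigl => k.
by rewrite -[in RHS]ltnS (leq_trans (ltn_ord k) le_n).
Qed.

Lemma flow_asm : exists A : 'M[int]_n, is_asm A /\ subordinate A X.
Proof.
have f01 a : 0 <= f (inl a) <= 1 by case: f_flow => fb _ _; apply: fb (inl a).
have row01 (i j : 'I_n) : 0 <= \sum_(k < n | (k <= j)%N) A i k <= 1 by rewrite row_prefix.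
have col01 (j i : 'I_n) : 0 <= \sum_(k < n | (k <= i)%N) A k j <= 1 by rewrite col_prefix.
have A_le1 i j := prefix01_bound (row01 i) j.
exists A; split; first split.
- by move=> i j; rewrite !inE; have := A_le1 i j; lia.
(* Each of the [n] line sums is at most 1 and their total is [n], so all equal 1. *)
- apply: eq1_of_sum_eq_card => [i|]; first exact: prefix01_total.
  by rewrite exchange_big flow_sum.
- apply: eq1_of_sum_eq_card => [j|]; last exact: flow_sum.
  exact: (prefix01_total (col01 j)).
- by move=> i; apply: prefix01_alternating.
- by move=> j; apply: (prefix01_alternating (col01 j)).
(* The flow on the arc is a nonnegative integer, so the bound on the entry makes it 0 or 1 wherever
   [X] is nonzero. *)
move=> i j; have := A_le1 i j; rewrite mxE.
have /andP[f0 _] : 0 <= f (inr (i, j)) <= cap (inr (i, j)) by case: f_flow.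
by have := X_sign i j; rewrite !inE => /or3P[] /eqP->; lia.
Qed.

End FlowToAsm.

(** * From a cut of capacity below [n] to a separated family *)

Section CutToFamily.
Variable U : {set node}.
Hypotheses (sourceU : source \in U) (sinkU : sink \notin U).
Hypothesis cut_lt : \sum_(a | (src a \in U) && (dst a \notin U)) cap a < n%:Z.

Let B1 : {set position n} := [set p | hnode p \in U].
Let B2 : {set position n} := [set p | vnode p \notin U].

(** Such an arc has capacity [n], which alone would exceed the bound on the cut. *)
Lemma xarc_not_cut p : X p.1 p.2 != 0 ->
  ~~ ((src (inr p) \in U) && (dst (inr p) \notin U)).
Proof.
move=> Xp; apply/negP=> pcut; move: cut_lt.
rewrite (bigD1 (inr p)) //= (negPf Xp) ltNge lerDl sumr_ge0 // => a _.
exact: cap_ge0.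
Qed.

Lemma cut_family : exists I1 I2 : {set {set position n}},
  [/\ separated_family I1 I2, (family_card I1 I2 < n)%N,
      forall i j, X i j = 1 -> (1 <= cover_mult I1 I2 (i, j))%N
    & forall i j, X i j = -1 -> (cover_mult I1 I2 (i, j) <= 1)%N].
Proof.
pose I1 := runs fst snd pair B1.
pose I2 := runs snd fst (fun j i => (i, j)) B2.
have pairK (p : position n) : (p.1, p.2) = p by case: p.
have mult p : cover_mult I1 I2 p = ((hnode p \in U) + (vnode p \notin U))%N.
  by rewrite /cover_mult !runs_cover // !inE.
exists I1, I2; split.
- split; split.
  + exact: runs_segment.
  + exact: trivIset_runs.
  + exact: runs_separated.
  + exact: runs_segment.
  + exact: trivIset_runs.
  + exact: runs_separated.
- rewrite -ltz_nat; apply: le_lt_trans cut_lt.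
  (* Past the end of a run comes a node outside [U], or the sink, which is outside [U] too; hence
     the unit arc there is cut. *)
  have card1 : (#|I1| <= #|[set p | (hnode p \in U) && (right_of p \notin U)]|)%N.
    apply: leq_trans (card_runs _ _ _) (subset_leq_card _) => //.
    apply/subsetP=> p; rewrite !inE => /andP[-> /forallP pe] /=.
    rewrite /right_of; case: insubP => [k _ kE|//].
    by move/implyP: (pe k); rewrite kE inE; apply.
  (* Dually, below the end of a vertical run lies a node of [U] or the source, also in [U]. *)
  have card2 : (#|I2| <= #|[set p | (below p \in U) && (vnode p \notin U)]|)%N.
    apply: leq_trans (card_runs _ _ _) (subset_leq_card _) => //.
    apply/subsetP=> p; rewrite !inE => /andP[-> /forallP pe] /=.
    rewrite andbT /below; case: insubP => [k _ kE|//].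
    by move/implyP: (pe k); rewrite kE inE negbK; apply.
  have := leq_add card1 card2; rewrite -lez_nat => /le_trans; apply.
  rewrite big_mkcond !big_sumType /= PoszD -[leLHS]addr0; apply: lerD; last first.
    by apply: sumr_ge0 => p _; case: ifP => // _; apply: (cap_ge0 (inr p)).
  by rewrite -!natz -!sumr_const; apply: lerD;
    rewrite big_mkcond; apply: ler_sum => p _; rewrite inE.
(* The uncut arc from [vnode] to [hnode] excludes multiplicity 0 here; for [-1] the reversed arc
   excludes multiplicity 2. *)
- move=> i j Xij; have := @xarc_not_cut (i, j); rewrite mult /= Xij eqxx.
  by move=> /(_ isT); case: (hnode _ \in U); case: (vnode _ \in U).
- move=> i j Xij; have := @xarc_not_cut (i, j); rewrite mult /= Xij.
  by move=> /(_ isT); case: (hnode _ \in U); case: (vnode _ \in U).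
Qed.

End CutToFamily.

(** * The flow-or-cut alternative and the equivalence *)

Lemma asm_or_family :
  (exists A : 'M[int]_n, is_asm A /\ subordinate A X) \/
  (exists I1 I2 : {set {set position n}},
    [/\ separated_family I1 I2, (family_card I1 I2 < n)%N,
        forall i j, X i j = 1 -> (1 <= cover_mult I1 I2 (i, j))%N
      & forall i j, X i j = -1 -> (cover_mult I1 I2 (i, j) <= 1)%N]).
Proof.
have sNt : source != sink by [].
have [[f f_flow]|[U [sU tU lt_c]]] := max_flow_min_cut src dst n sNt cap_ge0.
  by left; apply: flow_asm f_flow.
by right; apply: cut_family lt_c.
Qed.

End AsmNetwork.

Theorem theorem6p5 (n : nat) (X : 'M[int]_n) (hX : sign_valued X) :
  (exists A : 'M[int]_n, is_asm A /\ subordinate A X) <->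
  ~ (exists I1 I2 : {set {set position n}},
      [/\ separated_family I1 I2,
          (family_card I1 I2 < n)%N,
          forall i j : 'I_n, X i j = 1 -> (1 <= cover_mult I1 I2 (i, j))%N
        & forall i j : 'I_n, X i j = -1 -> (cover_mult I1 I2 (i, j) <= 1)%N]).
Proof.
split=> [[A [asmA subA]] [I1 [I2 [sepI cardI Xpos Xneg]]]|no_family].
  move: cardI; rewrite ltnNge => /negP; apply.
  (* Nonzero entries of [A] agree with those of [X], so both covering conditions pass from [X] to
     [A]. *)
  apply: asm_separated_family_card asmA sepI _ _ => i j Aij.
    by apply: Xpos; case: (subA i j); rewrite Aij.
  by apply: Xneg; case: (subA i j); rewrite Aij.
by case: (asm_or_family hX) => // /no_family.
Qed.
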